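(* Let $A$ be a finite nonempty alphabet and let $S\subset A^*$ be a uniformly recurrent tree set with $A\subset S$. Then for every $w\in S$, the set $\mathcal{R}_S(w)$ of first right return words to $w$ is a basis of the free group $F_A$ on $A$.
   Context: $A^*$ is the free monoid on $A$, $1$ the empty word, $A^+=A^*\setminus\{1\}$. A set $S\subset A^*$ is factorial if it contains all factors of its elements. For $w\in S$: $L(w)=\{a\in A\mid aw\in S\}$, $R(w)=\{a\in A\mid wa\in S\}$, $E(w)=\{(a,b)\in A\times A\mid awb\in S\}$. $S$ is biextendable if it is factorial and $E(w)\neq\emptyset$ for every $w\in S$; it is right-extendable if it is factorial and $R(w)\ne\emptyset$ for all $w\in S$. The extension graph of $w\in S$ is the undirected bipartite graph whose vertex set is the disjoint union of $L(w)$ and $R(w)$, with an edge between $a\in L(w)$ and $b\in R(w)$ for each $(a,b)\in E(w)$. $S$ is a tree set if it is biextendable and the extension graph of every $w\in S$ is a tree (connected and acyclic). $S$ is uniformly recurrent if it is right-extendable and for every $u\in S$ there is $n\ge1$ such that $u$ is a factor of every word of $S$ of length $n$. For $w\in S$, $\Gamma_S(w)=\{x\in S\mid wx\in S\cap A^+w\}$ and $\mathcal{R}_S(w)=\Gamma_S(w)\setminus\Gamma_S(w)A^+$. $F_A$ denotes the free group on $A$, containing $A^*$. *)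

(* Defs.v *)
From HB Require Import structures.
From mathcomp Require Import all_boot all_classical.

Set Implicit Arguments.
Unset Strict Implicit.
Unset Printing Implicit Defensive.

Local Open Scope classical_set_scope.

Section Words.
Variable A : finType.
Implicit Types (S X Y : set (seq A)) (u v w x : seq A).

Definition factorial_set S := forall u v, infix u v -> S v -> S u.

Definition left_ext S w : set A := [set a | S (a :: w)].
Definition right_ext S w : set A := [set b | S (rcons w b)].
Definition bi_ext S w : set (A * A) := [set ab | S (ab.1 :: rcons w ab.2)].

Definition biextendable S :=
  factorial_set S /\ forall w, S w -> bi_ext S w !=set0.

Definition right_extendable S :=
  factorial_set S /\ forall w, S w -> right_ext S w !=set0.

(* The vertex type is the disjoint union of the subtypes given by the sets
   left_ext S w and right_ext S w (coerced by set_type). *)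
Definition ext_vertex S w : finType := (left_ext S w + right_ext S w)%type.

Definition ext_edge S w : rel (ext_vertex S w) := fun p q =>
  match p, q with
  | inl a, inr b => (val a, val b) \in bi_ext S w
  | inr b, inl a => (val a, val b) \in bi_ext S w
  | _, _ => false
  end.

End Words.

(* These notions are meant for symmetric irreflexive relations, so that
   a ucycle of size 2 is an edge traversed back and forth, not a cycle of the
   undirected graph. *)
Definition connected_graph (V : finType) (e : rel V) :=
  forall x y : V, connect e x y.
Definition acyclic_graph (V : finType) (e : rel V) :=
  forall c : seq V, ucycle e c -> size c <= 2.
Definition tree_graph (V : finType) (e : rel V) :=
  connected_graph e /\ acyclic_graph e.

Lemma ext_edge_sym (A : finType) (S : set (seq A)) w :
  symmetric (@ext_edge A S w).
Proof. by case=> [a|b] [a'|b']. Qed.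

Lemma ext_edge_irr (A : finType) (S : set (seq A)) w :
  irreflexive (@ext_edge A S w).
Proof. by case. Qed.

Section WordSets.
Variable A : finType.
Implicit Types (S X Y : set (seq A)) (w : seq A).

Definition tree_set S :=
  biextendable S /\ forall w, S w -> tree_graph (@ext_edge A S w).

Definition uniformly_recurrent S :=
  right_extendable S /\
  forall u, S u ->
    exists2 n, 1 <= n & forall v, S v -> size v = n -> infix u v.

Definition nonempty_words : set (seq A) := [set u | u != [::]].

Definition word_mul X Y : set (seq A) := [set u ++ v | u in X & v in Y].

Definition right_returns S w : set (seq A) :=
  [set x | S x /\ (S `&` word_mul nonempty_words [set w]) (w ++ x)].

Definition first_right_returns S w : set (seq A) :=
  right_returns S w `\` word_mul (right_returns S w) nonempty_words.

End WordSets.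

(* The free group on T, realised as the reduced words over T * bool, where
   (t, true) stands for t and (t, false) for its inverse. *)

Section FreeGroup.
Variable T : choiceType.
Implicit Types (l : T * bool) (s r : seq (T * bool)).

Definition flip l : T * bool := (l.1, ~~ l.2).

Definition reduced s := sorted (fun l l' => l' != flip l) s.

Definition cons_step l s :=
  if s is l' :: s' then if l' == flip l then s' else l :: s else [:: l].

Definition reduce_onto s r := foldr cons_step r s.

Lemma flipK : involutive flip.
Proof. by case=> t b; rewrite /flip /= negbK. Qed.

Lemma reduced_behead l s : reduced (l :: s) -> reduced s.
Proof. exact: path_sorted. Qed.

Lemma reduced_step l s : reduced s -> reduced (cons_step l s).
Proof.
case: s => [//|l' s] sR; rewrite /cons_step.
by case: ifP => [_|ne]; [exact: reduced_behead sR|rewrite /reduced /= ne].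
Qed.

Lemma reduced_reduce_onto s r : reduced r -> reduced (reduce_onto s r).
Proof. by move=> rR; elim: s => //= l s IH; apply: reduced_step. Qed.

Lemma cons_stepK l s :
  reduced s -> cons_step (flip l) (cons_step l s) = s.
Proof.
case: s => [|l' s] sR /=; first by rewrite flipK eqxx.
case: eqP => [e|ne] /=; last by rewrite flipK eqxx.
subst l'; case: s sR => [//|k s] /=.
by rewrite /reduced /= => /andP[/negPf->].
Qed.

Lemma reduce_onto_id s : reduced s -> reduce_onto s [::] = s.
Proof.
elim: s => //= l s IH sR; rewrite IH ?(reduced_behead sR) //.
by case: s sR {IH} => [//|k s] /andP[/negPf /= -> _].
Qed.

Lemma reduce_onto_cat s1 s2 r :
  reduce_onto (s1 ++ s2) r = reduce_onto s1 (reduce_onto s2 r).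
Proof. exact: foldr_cat. Qed.

Lemma reduce_onto_step l s r : reduced r ->
  reduce_onto (cons_step l s) r = cons_step l (reduce_onto s r).
Proof.
move=> rR; case: s => [//|l' s] /=; case: eqP => //= ->.
have := cons_stepK (flip l) (reduced_reduce_onto s rR).
by rewrite flipK => ->.
Qed.

Lemma reduce_ontoA s1 s2 r : reduced r ->
  reduce_onto (reduce_onto s1 s2) r = reduce_onto s1 (reduce_onto s2 r).
Proof. by move=> rR; elim: s1 => //= l s IH; rewrite reduce_onto_step ?IH. Qed.

Record free_group := FreeGroup {fg_word : seq (T * bool); _ : reduced fg_word}.

HB.instance Definition _ := [isSub for fg_word].
HB.instance Definition _ := [Choice of free_group by <:].

Implicit Types g h : free_group.

Lemma fg_wordP g : reduced (fg_word g).
Proof. exact: valP g. Qed.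

Definition fg_reduce s : free_group :=
  FreeGroup (reduced_reduce_onto s (isT : reduced [::])).

Definition fg_mul g h : free_group :=
  FreeGroup (reduced_reduce_onto (fg_word g) (fg_wordP h)).
Definition fg_one : free_group := @FreeGroup [::] isT.
Definition fg_inv g : free_group := fg_reduce (rev (map flip (fg_word g))).

Lemma fg_mulA : associative fg_mul.
Proof.
by move=> g h k; apply: val_inj; rewrite /= reduce_ontoA ?fg_wordP.
Qed.

Lemma fg_mul1 : left_id fg_one fg_mul.
Proof. by move=> g; apply: val_inj. Qed.

Lemma fg_mulr1 : right_id fg_one fg_mul.
Proof. by move=> g; apply: val_inj; rewrite /= reduce_onto_id ?fg_wordP. Qed.

Lemma reduce_ontoVK s r : reduced r ->
  reduce_onto (rev (map flip s)) (reduce_onto s r) = r.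
Proof.
elim: s r => //= l s IH r rR; rewrite rev_cons -cats1 reduce_onto_cat /=.
by rewrite cons_stepK ?IH ?reduced_reduce_onto.
Qed.

Lemma fg_mulVg : left_inverse fg_one fg_inv fg_mul.
Proof.
move=> g; apply: val_inj; rewrite /= reduce_ontoA ?fg_wordP //=.
by rewrite -[X in reduce_onto _ X](reduce_onto_id (fg_wordP g)) reduce_ontoVK.
Qed.

Lemma fg_mulgV : right_inverse fg_one fg_inv fg_mul.
Proof.
move=> g; apply: val_inj => /=.
have {1}-> : fg_word g = rev (map flip (rev (map flip (fg_word g)))).
  by rewrite map_rev revK mapK //; exact: flipK.
by rewrite reduce_ontoVK.
Qed.

HB.instance Definition _ :=
  isGroup.Build free_group fg_mulA fg_mul1 fg_mulr1 fg_mulVg fg_mulgV.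

Definition fg_gen (t : T) : free_group := @FreeGroup [:: (t, true)] isT.

End FreeGroup.

Local Open Scope group_scope.

(* The morphism from the free group on T that extends f : T -> G. *)
Section Lift.
Variables (T : choiceType) (G : groupType) (f : T -> G).

Definition lift_letter (l : T * bool) : G := if l.2 then f l.1 else (f l.1)^-1.

Definition fg_lift (g : free_group T) : G :=
  \prod_(l <- fg_word g) lift_letter l.

Lemma fg_lift_gen t : fg_lift (fg_gen t) = f t.
Proof. by rewrite /fg_lift big_seq1. Qed.

Lemma lift_letter_flip l : lift_letter (flip l) = (lift_letter l)^-1.
Proof. by case: l => t []; rewrite /lift_letter /= ?invgK. Qed.

Lemma fg_liftM : {morph fg_lift : g h / g * h}.
Proof.
move=> g h; rewrite /fg_lift /=.
elim: (fg_word g) => [|l s IH] /=; first by rewrite big_nil mul1g.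
rewrite big_cons -mulgA -IH.
case: (reduce_onto s _) => [|k r] /=; first by rewrite big_seq1 big_nil mulg1.
case: eqP => [->|_]; last by rewrite big_cons.
by rewrite big_cons lift_letter_flip mulVKg.
Qed.

Lemma fg_lift1 : fg_lift 1 = 1.
Proof. exact: big_nil. Qed.

HB.instance Definition _ :=
  isUMagmaMorphism.Build (free_group T) G fg_lift (fg_lift1, fg_liftM).

End Lift.

(* X is a basis of G when the canonical morphism from the free group on X
   to G is an isomorphism. *)
Definition group_basis (G : groupType) (X : set G) :=
  bijective (fg_lift (fun x : X => val x : G)).

Definition fg_of_word (A : finType) (w : seq A) : free_group A :=
  \prod_(a <- w) fg_gen a.

Lemma fg_word_of_word (A : finType) (w : seq A) :
  fg_word (fg_of_word w) = [seq (a, true) | a <- w].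
Proof.
elim: w => [|a w IH]; first by rewrite /fg_of_word big_nil.
rewrite /fg_of_word big_cons -/(fg_of_word w) /= IH.
by case: w {IH} => [//|b w] /=; rewrite xpair_eqE andbF.
Qed.

(* Main.v *)
(* Let H be the subgroup generated by the first returns to w.  Words of S
   ending in w q get the coset H q, which is invariant under left extension.
   For long words this coset depends only on the last n letters, and the
   connectedness of the extension graph of each word of length n allows one to
   pass from n + 1 to n.  At n = 0 all cosets agree, hence H contains every
   letter.

   Dually, given f : R_S(w) -> G, label the last letter of a word of S ending
   in w x, x a first return, by f x, and every other letter by 1.  For long
   words this label depends only on the last n letters before it.  Since an
   edge labelling of an acyclic graph by elements of a group comes from a
   potential on the vertices, the extension graphs of the words of length n
   provide a gauge transformation that reduces n + 1 to n.  At n = 0 one gets a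
   morphism F_A -> G that extends f up to conjugation.  With G the free group on
   R_S(w), this shows that the canonical morphism G -> F_A is injective. *)

Require Import Defs.
From mathcomp Require Import all_boot all_classical.

Set Implicit Arguments.
Unset Strict Implicit.
Unset Printing Implicit Defensive.

Local Open Scope classical_set_scope.
Local Open Scope group_scope.

(** * Potentials on acyclic graphs *)

Lemma common_value (T : Type) (G : groupType) (P : T -> Prop) (F : T -> G) :
  (forall x x', P x -> P x' -> F x = F x') ->
  exists k, forall x, P x -> F x = k.
Proof.
move=> FP; case: (pselect (exists x, P x)) => [[x Px]|nP].
  by exists (F x) => y Py; apply: FP.
by exists 1 => x Px; case: nP; exists x.
Qed.

(** Induction on the number of edges. Removing an edge [a b] separates [a] from [b]; multiplying the
    potential on the left by a constant on the component of [b] preserves the relation on the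
    remaining edges and can be made to fit [c a b]. *)
Lemma acyclic_potential (V : finType) (G : groupType) (e : rel V)
    (c : V -> V -> G) :
  symmetric e -> irreflexive e -> acyclic_graph e ->
  (forall x y, e x y -> c y x = (c x y)^-1) ->
  exists p : V -> G, forall x y, e x y -> c x y = (p x)^-1 * p y.
Proof.
have [n] := ubnP #|[pred xy | e xy.1 xy.2]|.
elim: n e => // n IH e; rewrite ltnS => le_n e_sym e_irr e_acyc cV.
case: (pickP [pred xy | e xy.1 xy.2]) => [[a b] /= eab|e0]; last first.
  by exists (fun=> 1) => x y exy; have := e0 (x, y); rewrite /= exy.
pose e' x y := [&& e x y, (x, y) != (a, b) & (x, y) != (b, a)].
have e'e : subrel e' e by move=> x y /andP[].
have e'_sym : symmetric e'.
  move=> x y; rewrite /e' e_sym !xpair_eqE.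
  by case: (x == a); case: (x == b); case: (y == a); case: (y == b).
have [|||||p pP] := IH e'.
- apply: leq_trans le_n; apply: proper_card; apply/properP; split.
    by apply/fintype.subsetP => -[x y]; apply: e'e.
  by exists (a, b); rewrite !inE //= /e' eqxx andbF.
- by [].
- by move=> x; rewrite /e' e_irr.
- move=> s /andP[s_cyc s_uniq]; apply: e_acyc; rewrite /ucycle s_uniq andbT.
  exact: sub_cycle s_cyc.
- by move=> x y /e'e; apply: cV.
(* A path from [b] to [a] would close up with the removed edge into a cycle; size at most 2 forces a
   loop or the removed edge itself. *)
have ab_disc : ~~ connect e' b a.
  apply/negP => /connectP[q0 q0P].
  case/shortenP: q0P => q qP q_uniq _ ql.
  have : ucycle e (b :: q).
    rewrite /ucycle q_uniq andbT /= rcons_path -ql eab andbT.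
    exact: sub_path qP.
  move/e_acyc; case: q qP q_uniq ql => [|x [|//]] /=.
    by move=> _ _ ab; move: eab; rewrite ab e_irr.
  by rewrite andbT => e'bx _ ax; move: e'bx; rewrite -ax /e' eqxx !andbF.
have e'_csym : connect_sym e' by apply: sym_connect_sym.
(* [k] solves [k * p b = p a * c a b]. *)
pose k := p a * c a b * (p b)^-1.
pose p' x := if connect e' b x then k * p x else p x.
have p'E x y : e' x y -> c x y = (p' x)^-1 * p' y.
  move=> e'xy; rewrite /p' (same_connect_r e'_csym (connect1 e'xy)).
  case: ifP => _; last exact: pP.
  by rewrite invgM -mulgA mulKg; apply: pP.
have p'ab : c a b = (p' a)^-1 * p' b.
  by rewrite /p' connect0 (negPf ab_disc) /k !mulgA mulVg mul1g mulgVK.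
exists p' => x y exy.
case: (boolP (e' x y)) => [/p'E//|]; rewrite /e' exy /= -negb_or negbK.
case/orP => /eqP[-> ->]; first by [].
by rewrite (cV _ _ eab) p'ab invgM invgK.
Qed.

Section FreeGroupTheory.
Variable T : choiceType.

Lemma fg_morph_ext (G : groupType) (f h : free_group T -> G) :
  {morph f : x y / x * y} -> {morph h : x y / x * y} ->
  (forall t, f (fg_gen t) = h (fg_gen t)) -> f =1 h.
Proof.
move=> fM hM fh.
have morph1 (k : free_group T -> G) : {morph k : x y / x * y} -> k 1 = 1.
  by move=> kM; apply: (mulgI (k 1)); rewrite -kM !mulg1.
have morphV (k : free_group T -> G) : {morph k : x y / x * y} ->
    forall x, k x^-1 = (k x)^-1.
  move=> kM x; apply: (mulgI (k x)); rewrite -kM !mulgV; exact: morph1.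
have fhl l : f (@FreeGroup T [:: l] isT) = h (@FreeGroup T [:: l] isT).
  case: l => t []; first exact: fh.
  have -> : @FreeGroup T [:: (t, false)] isT = (fg_gen t)^-1 by apply: val_inj.
  by rewrite !morphV ?fh.
case=> s sR; elim: s sR => [|l s IH] sR.
  have -> : FreeGroup sR = 1 by apply: val_inj.
  by rewrite !morph1.
have -> : FreeGroup sR =
    @FreeGroup T [:: l] isT * FreeGroup (reduced_behead sR).
  apply: val_inj => /=; case: s sR {IH} => //= k s /andP[/negPf /= kl _].
  by rewrite kl.
by rewrite fM hM fhl IH.
Qed.

End FreeGroupTheory.

Lemma fg_of_word_cat (A : finType) (u v : seq A) :
  fg_of_word (u ++ v) = fg_of_word u * fg_of_word v.
Proof. exact: big_cat. Qed.

Lemma fg_of_word_rcons (A : finType) (u : seq A) b :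
  fg_of_word (rcons u b) = fg_of_word u * fg_gen b.
Proof. by rewrite -cats1 fg_of_word_cat /fg_of_word big_seq1. Qed.

(** * Return words and occurrences of [w] *)

Section Returns.
Variables (A : finType) (S : set (seq A)).
Hypothesis S_fact : factorial_set S.
Implicit Types (u v w x y z p q : seq A) (a b : A).

Lemma factorial_catl u v : S (u ++ v) -> S u.
Proof. by apply: S_fact; apply/infixP; exists [::], v. Qed.

Lemma factorial_catr u v : S (u ++ v) -> S v.
Proof. by apply: S_fact; apply/infixP; exists u, [::]; rewrite cats0. Qed.

Variable w : seq A.

Lemma right_returnsP p y :
  p != [::] -> S (w ++ y) -> w ++ y = p ++ w -> right_returns S w y.
Proof.
move=> p0 Swy e; split; first exact: factorial_catr Swy.
by split=> //; exists p => //; exists w.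
Qed.

Lemma right_returns_suffix y : right_returns S w y ->
  exists2 p, p != [::] & w ++ y = p ++ w.
Proof. by case=> _ [_ [p p0 [_ -> e]]]; exists p. Qed.

Lemma right_returns_neq0 y : right_returns S w y -> y != [::].
Proof.
case/right_returns_suffix => p p0 /(congr1 size); rewrite !size_cat addnC.
by move/addIn; case: y => //= /esym/size0nil p_nil; rewrite p_nil in p0.
Qed.

Lemma first_right_returns_minimal x y z : first_right_returns S w x ->
  right_returns S w y -> z != [::] -> x <> y ++ z.
Proof. by case=> _ nx Ry z0 e; apply: nx; exists y => //; exists z. Qed.

(** The earlier [w], followed by the text up to the end of the later one, ends in [w]; the two
    occurrences may overlap. *)
Lemma right_returns_between p q p' q' : S (p ++ w ++ q) ->
  p ++ w ++ q = p' ++ w ++ q' -> size p < size p' ->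
  exists2 y, right_returns S w y & q = y ++ q'.
Proof.
move=> Sq e lt_p.
have [r r0 p'E] : exists2 r, r != [::] & p' = p ++ r.
  exists (drop (size p) p').
    by rewrite -size_eq0 size_drop subn_eq0 -ltnNge.
  have := congr1 (take (size p)) e.
  rewrite take_size_cat // takel_cat ?(ltnW lt_p) // => pE.
  by rewrite -[LHS](cat_take_drop (size p) p') -pE.
have e1 : w ++ q = r ++ w ++ q'.
  by apply/eqP; move/eqP: e; rewrite p'E -catA eqseq_cat // => /andP[].
pose y := drop (size w) (r ++ w).
have rwE : r ++ w = w ++ y.
  have := congr1 (take (size w)) e1.
  rewrite take_size_cat // catA takel_cat ?size_cat ?leq_addl // => wE.
  by rewrite -[LHS](cat_take_drop (size w)) -wE.
have qE : q = y ++ q'.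
  apply/eqP; move/eqP: e1; rewrite catA rwE -catA eqseq_cat //.
  by case/andP.
exists y => //; apply: (right_returnsP r0) => //.
by move/factorial_catr: Sq; rewrite qE catA => /factorial_catl.
Qed.

(** Induction on length: if a return [y1 ++ y2] is cut after a shorter return [y1], then [y2] links
    the occurrences of [w] ending [w ++ y1] and [w ++ y1 ++ y2], so it is a return too. *)
Lemma right_returns_ind (H : seq A -> Prop) :
  (forall x, first_right_returns S w x -> H x) ->
  (forall x y, H x -> H y -> H (x ++ y)) ->
  forall y, right_returns S w y -> H y.
Proof.
move=> HR Hcat y; have [n] := ubnP (size y).
elim: n y => // n IH y; rewrite ltnS => le_n Ry.
case: (pselect (word_mul (right_returns S w) (@nonempty_words A) y)); last first.
  by move=> ny; apply: HR; split.
case=> y1 Ry1 [y2 y20 yE]; subst y.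
have Ry2 : right_returns S w y2.
  have [p p0 e1] := right_returns_suffix Ry1.
  have [p' p'0 e2] := right_returns_suffix Ry.
  have Sy : S (w ++ y1 ++ y2) by case: Ry => _ [].
  have e3 : p ++ w ++ y2 = p' ++ w ++ [::] by rewrite cats0 -e2 !catA e1.
  have [|| y Ry' ->] := right_returns_between _ e3.
  - by rewrite catA -e1 -catA.
  - have := congr1 size e3; rewrite !size_cat addn0 [size w + _]addnC addnA.
    move/addIn => <-; rewrite -addn1 leq_add2l lt0n size_eq0.
    exact: y20.
  by rewrite cats0.
apply: Hcat; apply: IH => //; apply: leq_trans le_n; rewrite size_cat.
  by rewrite -addn1 leq_add2l lt0n size_eq0.
by rewrite -add1n leq_add2r lt0n size_eq0 (right_returns_neq0 Ry1).
Qed.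


(** * Labels read off from first returns *)

Section Label.
Variable G : groupType.
Variable f : seq A -> G.

(* Multiplying the labels of the successive prefixes of a word of [S] between
   two occurrences of [w] gives the product of the values of [f] at the
   consecutive first returns. *)
Definition return_label z : G :=
  match pselect (exists2 x, first_right_returns S w x & suffix (w ++ x) z) with
  | left ex => f (projT1 (cid2 ex))
  | right _ => 1
  end.

(** If two first returns fitted, the longer would begin with a shorter return. *)
Lemma return_label_suffix x z : S z -> first_right_returns S w x ->
  suffix (w ++ x) z -> return_label z = f x.
Proof.
move=> Sz Rx zx; rewrite /return_label; case: pselect => [ex|[]]; last by exists x.
case: cid2 => x' Rx' zx' /=; congr f.
have /suffixP[p zE] := zx; have /suffixP[p' z'E] := zx'; subst z.
case: (ltngtP (size p) (size p')) => [lt_p|lt_p|eq_p].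
- have [y Ry xE] := right_returns_between Sz z'E lt_p.
  have x'0 : x' != [::] := right_returns_neq0 (proj1 Rx').
  by case: (first_right_returns_minimal Rx Ry x'0 xE).
- rewrite z'E in Sz.
  have [y Ry xE] := right_returns_between Sz (esym z'E) lt_p.
  have x0 : x != [::] := right_returns_neq0 (proj1 Rx).
  by case: (first_right_returns_minimal Rx' Ry x0 xE).
- move/eqP: z'E; rewrite eqseq_cat // => /andP[_].
  by rewrite eqseq_cat // eqxx => /eqP.
Qed.

Lemma return_label_nosuffix z :
  (forall x, first_right_returns S w x -> suffix (w ++ x) z -> False) ->
  return_label z = 1.
Proof.
move=> nz; rewrite /return_label; case: pselect => // ex.
by case: (ex) => x Rx xz; case: (nz x Rx xz).
Qed.

(** The new letter matters only if the whole word is some [w ++ x]; the occurrence of [w] inside [u]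
    then cuts a shorter return off [x]. *)
Lemma return_label_cons a u b : infix w u -> S (a :: rcons u b) ->
  return_label (a :: rcons u b) = return_label (rcons u b).
Proof.
move=> wu Sz; have Sub : S (rcons u b) by apply: factorial_catr (Sz : S ([:: a] ++ _)).
case: (pselect (exists2 x, first_right_returns S w x & suffix (w ++ x) (rcons u b))).
  case=> x Rx xz; rewrite !(@return_label_suffix x) //.
  exact: suffix_trans xz (suffix_cons _ _).
move=> nx; rewrite !return_label_nosuffix // => x Rx xz; first by case: nx; exists x.
case/suffixP: xz => -[|c p] /= zE; last first.
  case: zE => _ zE; apply: nx; exists x => //.
  by apply/suffixP; exists p.
case/infixP: wu zE => p1 [q1 ->] zE.
have zE' : [::] ++ w ++ x = (a :: p1) ++ w ++ rcons q1 b.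
  by rewrite /= -zE -!cats1 -!catA.
have Sx : S ([::] ++ w ++ x) by case: Rx => -[_ []].
have [//|y Ry xE] := right_returns_between Sx zE'.
by apply: (first_right_returns_minimal Rx Ry _ xE); case: (q1).
Qed.

Lemma return_label_prefix x y z : first_right_returns S w x ->
  x = y ++ z -> z != [::] -> return_label (w ++ y) = 1.
Proof.
move=> Rx xE z0; apply: return_label_nosuffix => x' Rx' /suffixP[p yE].
have [p' p'0 x'E] := right_returns_suffix (proj1 Rx').
apply: (first_right_returns_minimal Rx _ z0 xE).
apply: (@right_returnsP (p ++ p')); last by rewrite yE x'E catA.
  by case: (p) p'0.
by case: Rx => -[_ []]; rewrite xE catA => /factorial_catl.
Qed.

(** * Gauge transformations and descent on the suffix length *)

Section Gauge.
Hypothesis S_tree : tree_set S.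

(** Along successive prefixes the values of [g] telescope. *)
Definition gauged (g : seq A -> G) u b :=
  (g u)^-1 * return_label (rcons u b) * g (rcons u b).

(* The invariance of [g] makes [g (w ++ x) = g w] for every return [x], so that
   a gauge transformation conjugates the value of a return by [g w]. *)
Definition gauge n (g : seq A -> G) :=
  (forall p u, infix w u -> g (p ++ u) = g u) /\
  forall v p p' b, size v = n ->
    S (rcons (p ++ v) b) -> S (rcons (p' ++ v) b) ->
    infix w (p ++ v) -> infix w (p' ++ v) ->
    gauged g (p ++ v) b = gauged g (p' ++ v) b.

Lemma gauged_cat g : (forall p u, infix w u -> g (p ++ u) = g u) ->
  forall p u b, infix w u -> S (rcons (p ++ u) b) ->
  gauged g (p ++ u) b = gauged g u b.
Proof.
move=> gI p u b wu Su; rewrite /gauged -!cats1 -!catA gI // (gI p (u ++ _)) ?infix_catr //.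
congr (_ * _ * _); rewrite !cats1 -rcons_cat.
elim: p Su => //= a p IH Su; rewrite return_label_cons ?infix_catl //.
by apply: IH; apply: factorial_catr (Su : S ([:: a] ++ _)).
Qed.

Lemma gauge_start n : (forall v, S v -> size v = n -> infix w v) ->
  gauge n (fun=> 1).
Proof.
move=> wn; split=> // v p p' b sz Sp Sp' _ _.
have wv : infix w v.
  apply: wn => //; move: Sp; rewrite -cats1 -catA => /factorial_catr.
  exact: factorial_catl.
by rewrite !gauged_cat.
Qed.

(** By the hypothesis the gauged label depends only on the pair [(a, b)], so it labels the edges of
    the extension graph of [v]; the two components of [ts] are the potential on left and right
    vertices. *)
Lemma gauge_potential n g v : gauge n.+1 g -> size v = n -> S v ->
  exists ts : (A -> G) * (A -> G), forall p a b, S (rcons (p ++ a :: v) b) ->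
    infix w (p ++ a :: v) ->
    gauged g (p ++ a :: v) b = (ts.1 a)^-1 * ts.2 b.
Proof.
move=> [gI gP] sz Sv.
have [k kP] : exists k : A -> A -> G, forall a b p,
    S (rcons (p ++ a :: v) b) /\ infix w (p ++ a :: v) ->
    gauged g (p ++ a :: v) b = k a b.
  have kab (ab : A * A) : exists k : G, forall p,
    S (rcons (p ++ ab.1 :: v) ab.2) /\ infix w (p ++ ab.1 :: v) ->
    gauged g (p ++ ab.1 :: v) ab.2 = k.
    apply: common_value => p p' [Sp wp] [Sp' wp'].
    by apply: gP => //=; rewrite sz.
  have [k kP] := choice kab.
  by exists (fun a b => k (a, b)) => a b p; apply: (kP (a, b)).
pose c (x y : ext_vertex S v) : G := match x, y with
  | inl a, inr b => k (val a) (val b)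
  | inr b, inl a => (k (val a) (val b))^-1
  | _, _ => 1
  end.
have [_ /(_ v Sv)[_ e_acyc]] := S_tree.
have [|pi piP] := @acyclic_potential _ G (@ext_edge A S v) c
    (@ext_edge_sym A S v) (@ext_edge_irr A S v) e_acyc.
  by case=> x [y|y] //= _; rewrite invgK.
pose t a := if pselect (left_ext S v a) is left h then
  pi (inl (exist _ a (mem_set h))) else 1.
pose s b := if pselect (right_ext S v b) is left h then
  pi (inr (exist _ b (mem_set h))) else 1.
exists (t, s) => p a b Spb wp; rewrite (kP a b) // /t /s /=.
move: Spb; rewrite rcons_cat => /factorial_catr Sab.
case: pselect => [ha|[]]; last first.
  by move: Sab; rewrite -cats1 => /factorial_catl.
case: pselect => [hb|[]]; last first.
  exact: factorial_catr (Sab : S ([:: a] ++ _)).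
rewrite -piP //=; exact: mem_set.
Qed.

Lemma gauge_step n g : gauge n.+1 g -> exists g', gauge n g'.
Proof.
move=> gn; have [gI gP] := gn.
have ex v : exists t : (A -> G) * (A -> G), size v = n -> S v ->
    forall p a b, S (rcons (p ++ a :: v) b) -> infix w (p ++ a :: v) ->
    gauged g (p ++ a :: v) b = (t.1 a)^-1 * t.2 b.
  case: (pselect (size v = n /\ S v)) => [[sz Sv]|nv].
    by have [t tP] := gauge_potential gn sz Sv; exists t.
  by exists (fun=> 1, fun=> 1) => sz Sv; case: nv.
have [ts tsP] := choice ex.
(* [tau] cancels the left potential of the last [n] letters. It is 1 when these contain [w], or when
   [u] has at most [n] letters, which keeps it invariant under left extension of words containing
   [w]. *)
pose tau u := if drop (size u - n.+1) u is a :: v then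
  if (size v == n) && ~~ infix w v then ((ts v).1 a)^-1 else 1 else 1.
have tauE p a v : size v = n ->
    tau (p ++ a :: v) = if infix w v then 1 else ((ts v).1 a)^-1.
  move=> sz; rewrite /tau size_cat /= sz addnK drop_size_cat // sz eqxx /=.
  by case: infix.
have tau_cat p z : size z = n.+1 -> tau (p ++ z) = tau z.
  by case: z => //= a v [sz]; rewrite tauE // -(tauE [::]).
have tauI p u : infix w u -> tau (p ++ u) = tau u.
  elim: p => //= a p IH wu; rewrite -IH //.
  have {IH wu} : infix w (p ++ u) by apply: infix_catl.
  move: (p ++ u) => {p}u wu; case: (ltnP n (size u)) => [lt_n|le_n].
    have sz : size (drop (size u - n.+1) u) = n.+1 by rewrite size_drop subKn.
    rewrite -[u](cat_take_drop (size u - n.+1)) -cat_cons.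
    by rewrite !(tau_cat _ (drop _ _)).
  rewrite /tau /= subSS (eqP le_n) (eqP (leqW le_n)) !drop0 wu andbF.
  by case: (u) le_n => //= c v lt_n; rewrite ltn_eqF.
exists (fun u => g u * tau u); split.
  by move=> p u wu; rewrite gI // tauI.
move=> v p p' b sz Sp Sp' wp wp'.
case: (boolP (infix w v)) => [wv|nwv].
  rewrite !gauged_cat //; by move=> q u wu; rewrite gI // tauI.
have Sv : S v.
  by move: Sp; rewrite rcons_cat -cats1 => /factorial_catr/factorial_catl.
have rc q : infix w (q ++ v) -> exists r a, q = rcons r a.
  by case/lastP: q => [|r a] /=; [rewrite (negPf nwv)|exists r, a].
(* As [w] is not in [v], a letter [a] precedes [v]; its potential cancels, leaving a value that
   depends on [v] and [b] only. *)
have key q : S (rcons (q ++ v) b) -> infix w (q ++ v) ->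
  gauged (fun u => g u * tau u) (q ++ v) b = (ts v).2 b * tau (rcons v b).
  move=> Sq wq; have [r [a qE]] := rc _ wq; subst q.
  rewrite cat_rcons in Sq wq *.
  have tau_rcons : tau (rcons (r ++ a :: v) b) = tau (rcons v b).
    by rewrite -cat_rcons rcons_cat tau_cat ?size_rcons ?sz.
  have := tsP v sz Sv r a b Sq wq; rewrite /gauged => E.
  rewrite tauE // (negPf nwv) invgM invgK tau_rcons.
  by rewrite -!mulgA (mulgA (g _)^-1) (mulgA (_ * _) (g _)) E -mulgA mulVKg.
by rewrite !key.
Qed.


(** With a gauge at level 0, the gauged label of a letter depends on that letter alone and defines
    [t]; the conjugating element is [g w]. *)
Lemma first_return_morphism : uniformly_recurrent S -> S w ->
  exists (t : A -> G) (c : G), forall x, first_right_returns S w x ->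
    fg_lift t (fg_of_word x) = c^-1 * f x * c.
Proof.
move=> S_rec Sw; have [n _ wn] := S_rec.2 w Sw.
have [g [gI gP]] : exists g, gauge 0 g.
  have := gauge_start wn.
  move: (fun=> 1) => g; elim: n {wn} g => [|n IH] g; first by exists g.
  by case/gauge_step.
have ex b : exists k, forall p, S (rcons p b) /\ infix w p -> gauged g p b = k.
  apply: common_value => p p' [Sp wp] [Sp' wp'].
  by have := gP [::] p p' b; rewrite !cats0; apply.
have [t tP] := choice ex.
(* Labels inside a first return are 1, so only the telescoping [g] remains. *)
have prefixP x y z : first_right_returns S w x -> x = y ++ z -> z != [::] ->
    fg_lift t (fg_of_word y) = (g w)^-1 * g (w ++ y).
  move=> Rx; elim/last_ind: y z => [|y b IH] z xE z0.
    by rewrite cats0 mulVg /fg_of_word big_nil fg_lift1.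
  have Swx : S (w ++ x) by case: Rx => -[_ []].
  rewrite fg_of_word_rcons fg_liftM fg_lift_gen (IH (b :: z)) -?cat_rcons //.
  rewrite -(tP b (w ++ y)) /gauged; last first.
    split; last exact: prefix_infix.
    by move: Swx; rewrite xE rcons_cat catA => /factorial_catl.
  by rewrite rcons_cat (return_label_prefix Rx xE z0) mulg1 !mulgA mulgK.
exists t, (g w) => x Rx; have := right_returns_neq0 (proj1 Rx).
case/lastP: x Rx => // y b Rx _.
have Swx : S (w ++ rcons y b) by case: Rx => -[_ []].
rewrite fg_of_word_rcons fg_liftM fg_lift_gen.
rewrite (prefixP _ y [:: b] Rx (esym (cats1 _ _)) isT) -(tP b (w ++ y)); last first.
  by rewrite rcons_cat; split=> //; apply: prefix_infix.
rewrite /gauged rcons_cat (return_label_suffix Swx Rx (suffix_refl _)).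
(* Since [w ++ x] ends in [w], invariance gives [g (w ++ x) = g w]. *)
have [p _ ->] := right_returns_suffix (proj1 Rx).
by rewrite (gI p w (infix_refl w)) !mulgA mulgK.
Qed.

End Gauge.

End Label.

(** * Generation by first returns, through cosets *)

Section Generation.
Hypothesis S_rec : uniformly_recurrent S.
Hypothesis S_tree : tree_set S.
Hypothesis Sw : S w.

Lemma left_extension n v : S v -> exists2 p, size p = n & S (p ++ v).
Proof.
elim: n v => [|n IH] v Sv; first by exists [::].
have [[_ /(_ v Sv)[[a b] /= Sab]] _] := S_tree.
have [|p <- Sp] := IH (a :: v); last first.
  by exists (rcons p a); rewrite ?size_rcons ?cat_rcons.
by move: Sab; rewrite /bi_ext /= -rcons_cons -cats1 => /factorial_catl.
Qed.

Lemma left_extension_occ v : S v -> exists p q, S (p ++ w ++ q ++ v).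
Proof.
move=> Sv; have [n _ wn] := S_rec.2 w Sw.
have [p0 sz Sp] := left_extension n Sv.
have /infixP[p [q p0E]] := wn p0 (factorial_catl Sp) sz.
by exists p, q; rewrite catA catA -(catA p) -p0E.
Qed.

(** [H] stands for any subgroup containing the first returns; [same_coset g h] below means
    [H g = H h]. *)
Variable H : free_group A -> Prop.
Hypothesis H1 : H 1.
Hypothesis HM : forall g h, H g -> H h -> H (g * h).
Hypothesis HV : forall g, H g -> H g^-1.
Hypothesis HR : forall x, first_right_returns S w x -> H (fg_of_word x).

Let same_coset (g h : free_group A) := H (g * h^-1).

Let same_sym g h : same_coset g h -> same_coset h g.
Proof. by move/HV; rewrite /same_coset invgM invgK. Qed.

Let same_trans h g k : same_coset g h -> same_coset h k -> same_coset g k.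
Proof. by move=> gh /(HM gh); rewrite /same_coset mulgA mulgVK. Qed.

Let same_mulr k g h : same_coset (g * k) (h * k) <-> same_coset g h.
Proof. by rewrite /same_coset invgM mulgA mulgK. Qed.

(** The two tails differ by a return on the left, which is a product of first returns: the coset
    does not depend on the occurrence of [w] chosen. *)
Lemma same_occ p q p' q' : S (p ++ w ++ q) ->
  p ++ w ++ q = p' ++ w ++ q' -> same_coset (fg_of_word q) (fg_of_word q').
Proof.
have HRR y : right_returns S w y -> H (fg_of_word y).
  apply: (right_returns_ind (H := fun x => H (fg_of_word x)) HR) => x x' Hx Hx'.
  by rewrite fg_of_word_cat; apply: HM.
move=> Sq e; case: (ltngtP (size p) (size p')) => [lt_p|lt_p|eq_p].
- have [y Ry ->] := right_returns_between Sq e lt_p.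
  by rewrite /same_coset fg_of_word_cat mulgK; apply: HRR.
- rewrite e in Sq; have [y Ry ->] := right_returns_between Sq (esym e) lt_p.
  by apply: same_sym; rewrite /same_coset fg_of_word_cat mulgK; apply: HRR.
- move/eqP: e; rewrite eqseq_cat // eqseq_cat // eqxx => /andP[_ /eqP->].
  by rewrite /same_coset mulgV.
Qed.

Definition suffix_determined n := forall v p q p' q', size v = n ->
  S (p ++ w ++ q) -> S (p' ++ w ++ q') ->
  suffix v (p ++ w ++ q) -> suffix v (p' ++ w ++ q') ->
  same_coset (fg_of_word q) (fg_of_word q').

Lemma suffix_determined_occ v p q p' q' : infix w v ->
  S (p ++ w ++ q) -> S (p' ++ w ++ q') ->
  suffix v (p ++ w ++ q) -> suffix v (p' ++ w ++ q') ->
  same_coset (fg_of_word q) (fg_of_word q').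
Proof.
case/infixP=> p0 [q0 ->] Sq Sq' /suffixP[r e] /suffixP[r' e'].
apply: (@same_trans (fg_of_word q0)); first by apply: (same_occ Sq); rewrite e catA.
by apply: same_sym; apply: (same_occ Sq'); rewrite e' catA.
Qed.

Lemma suffix_determined_start : exists n, suffix_determined n.
Proof.
have [n _ wn] := S_rec.2 w Sw; exists n => v p q p' q' sz Sq Sq' vq vq'.
apply: (@suffix_determined_occ v p q p' q') => //; apply: wn => //.
exact: S_fact (suffixW vq) Sq.
Qed.

Lemma suffix_determined_step n : suffix_determined n.+1 -> suffix_determined n.
Proof.
move=> dn v p q p' q' sz Sq Sq' vq vq'.
case: (boolP (infix w v)) => [wv|nwv].
  exact: (@suffix_determined_occ v p q p' q').
have extend r s : suffix v (r ++ w ++ s) -> exists a, suffix (a :: v) (r ++ w ++ s).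
  case/suffixP => u; case/lastP: u => [e|u a ->].
    by case/negP: nwv; rewrite -[v]/([::] ++ v) -e infix_infix.
  by exists a; rewrite cat_rcons suffix_suffix.
have [a aq] := extend _ _ vq; have [a' aq'] := extend _ _ vq'.
have Sa : S (a :: v) by apply: S_fact (suffixW aq) Sq.
have Sa' : S (a' :: v) by apply: S_fact (suffixW aq') Sq'.
have Sv : S v by apply: factorial_catr (Sa : S ([:: a] ++ _)).
pose c := fg_of_word q.
(* Words ending in [a :: v] should have coset [H c], and words ending in [rcons v b] coset [H c b].
   Both suffixes have length [n.+1], so one word realising an edge carries the property across
   it. *)
pose P (x : ext_vertex S v) := match x with
  | inl a => forall p q, S (p ++ w ++ q) -> suffix (val a :: v) (p ++ w ++ q) ->
      same_coset (fg_of_word q) c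
  | inr b => forall p q, S (p ++ w ++ q) -> suffix (rcons v (val b)) (p ++ w ++ q) ->
      same_coset (fg_of_word q) (c * fg_gen (val b))
  end.
have edge b b' : S (b :: rcons v b') -> exists p q,
    [/\ S (p ++ w ++ q), suffix (b :: v) (p ++ w ++ q),
        S (p ++ w ++ rcons q b') &  suffix (rcons v b') (p ++ w ++ rcons q b')].
  move/left_extension_occ => [r [s Srs]]; exists r, (s ++ b :: v).
  split.
  - by move: Srs; rewrite -rcons_cons -!rcons_cat -cats1 => /factorial_catl.
  - by rewrite !catA suffix_suffix.
  - by rewrite rcons_cat.
  - by rewrite rcons_cat rcons_cons -cat_rcons !catA suffix_suffix.
have P_step (x y : ext_vertex S v) : ext_edge x y -> P x -> P y.
  case: x y => [x|x] [y|y] //= /set_mem /edge[r [s [S1 s1 S2 s2]]] Px r' s' S3 s3.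
    have := dn _ _ _ _ _ _ S3 S2 s3 s2; rewrite size_rcons sz => /(_ erefl) e.
    apply: same_trans e _; rewrite fg_of_word_rcons; apply/same_mulr.
    exact: Px S1 s1.
  have := dn _ _ _ _ _ _ S3 S1 s3 s1; rewrite /= sz => /(_ erefl) e.
  apply: same_trans e _; apply/(same_mulr (fg_gen (val x))).
  by rewrite -fg_of_word_rcons; apply: Px S2 s2.
have P_connect (x y : ext_vertex S v) : connect (@ext_edge A S v) x y -> P x -> P y.
  case/connectP=> s; elim: s x => /= [|z s IH] x; first by move=> _ ->.
  by case/andP=> xz zs ys /(P_step _ _ xz); apply: IH.
have [_ /(_ v Sv)[e_conn _]] := S_tree.
pose va b (h : S (b :: v)) : ext_vertex S v := inl (exist _ b (mem_set h)).
apply: same_sym; apply: (P_connect _ _ (e_conn (va a Sa) (va a' Sa')) _ _ _ Sq' aq').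
move=> r s Ss ss; apply: dn Ss Sq ss aq.
by rewrite /= sz.
Qed.

Lemma first_returns_generate a : S [:: a] -> H (fg_gen a).
Proof.
have [n dn] := suffix_determined_start => Sa.
have {n dn} d0 : suffix_determined 0.
  by elim: n dn => // n IH /suffix_determined_step.
have [p [q Sq]] := left_extension_occ Sa.
(* At level 0 the comparison is with [w] itself, whose tail is empty. Applied to [q] and
   [rcons q a], this isolates [a]. *)
have occ r : S (p ++ w ++ r) -> H (fg_of_word r).
  move=> Sr; have := d0 [::] p r [::] [::] erefl Sr; rewrite cats0 !suffix0s.
  by rewrite /same_coset /fg_of_word big_nil invg1 mulg1; apply.
have := occ _ Sq; rewrite cats1 fg_of_word_rcons => Hqa.
rewrite -[fg_gen a](mulKg (fg_of_word q)); apply: HM => //; apply: HV.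
by apply: occ; move: Sq; rewrite catA catA => /factorial_catl; rewrite -catA.
Qed.

End Generation.

End Returns.

(** * Surjectivity and injectivity combined *)

Theorem theorem4p5 (A : finType) (S : set (seq A))
  (A_gt0 : 0 < #|A|)
  (S_rec : uniformly_recurrent S)
  (S_tree : tree_set S)
  (A_sub_S : forall a : A, S [:: a]) :
  forall w : seq A, S w ->
    group_basis ((@fg_of_word A) @` first_right_returns S w).
Proof.
move=> w Sw; rewrite /group_basis; set X := image _ _.
have S_fact : factorial_set S by case: S_rec => -[].
set phi := fg_lift _.
pose elt g (h : X g) : X := exist _ g (mem_set h).
have phiM : {morph phi : x y / x * y} by apply: fg_liftM.
have ex a : exists y, phi y = fg_gen a.
  (* Surjectivity: the subgroup is the range of [phi]. *)
  pose H g := exists y : free_group X, phi y = g.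
  apply: (first_returns_generate S_fact S_rec S_tree Sw (H := H)) => //.
  - by exists 1; apply: fg_lift1.
  - by move=> _ _ [x <-] [y <-]; exists (x * y); rewrite phiM.
  - by move=> _ [x <-]; exists x^-1; rewrite /phi gmulfV.
  - move=> x Rx; have Xx : X (fg_of_word x) by exists x.
    by exists (fg_gen (elt _ Xx)); rewrite /phi fg_lift_gen.
have [s sP] := choice ex.
have phi_s : cancel (fg_lift s) phi.
  apply: fg_morph_ext => [x y|//|t]; first by rewrite fg_liftM phiM.
  by rewrite fg_lift_gen.
pose f x := if pselect (X (fg_of_word x)) is left h then
  fg_gen (elt _ h) else 1.
have [t [c tP]] := first_return_morphism S_fact f S_tree S_rec Sw.
(* Conjugation by [c] is a morphism, so it suffices to compare on generators; being injective, it
   makes [phi] injective. *)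
have t_phi x : fg_lift t (phi x) = c^-1 * x * c.
  move: x; apply: fg_morph_ext => [x y|x y|[g gX]].
  - by rewrite phiM fg_liftM.
  - by rewrite !mulgA mulgK.
  - rewrite /phi fg_lift_gen /=; have [x Rx xE] := set_mem gX.
    rewrite -[in LHS]xE tP // /f; case: pselect => [h|[]]; last by exists x.
    by congr (_ * fg_gen _ * _); apply: val_inj.
exists (fg_lift s) => // x.
have phi_inj : injective phi.
  by move=> y z /(congr1 (fg_lift t)); rewrite !t_phi => /mulIg/mulgI.
by apply: phi_inj; rewrite phi_s.
Qed.
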